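(* Let $\mathbb{X},\mathbb{Y}$ be Banach spaces, $g:\mathbb{X}\to\mathbb{Y}$ continuously differentiable and $f:\mathbb{Y}\to\mathbb{R}\cup\{+\infty\}$ proper, lower semicontinuous and convex. Let $S_f:=\{y\in\mathbb{Y}:f(y)\le0\}$ and $\mathcal{S}:=\{x\in\mathbb{X}:f(g(x))\le0\}$, and assume ${\rm bd}(S_f)\subseteq f^{-1}(0)$. Let $\bar x\in\mathcal{S}$ be such that $g(\bar x)\in{\rm int}({\rm dom} f)$ and $g$ is metrically regular around $\bar x$. Then the inequality $(f\circ g)(x)\le0$ has a local error bound at $\bar x$ if and only if $$\limsup_{x\xrightarrow{{\rm bd}(\mathcal{S})}\bar x}\mathbf{e}\Big(\{h\in\mathbb{X}:\mathbf{d}^+f(g(x),\nabla g(x)(h))\le1\},\ \nabla g(x)^{-1}\big(\mathbf{T}^{\mathbf B}(S_f,g(x))\big)\Big)<+\infty.$$ Moreover, $$\tau(\mathcal{S},\bar x)=\limsup_{x\xrightarrow{{\rm bd}(\mathcal{S})}\bar x}\mathbf{e}\Big(\{h\in\mathbb{X}:\mathbf{d}^+f(g(x),\nabla g(x)(h))\le1\},\ \nabla g(x)^{-1}\big(\mathbf{T}^{\mathbf B}(S_f,g(x))\big)\Big).$$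
   Context: $\mathbf{B}(a,\delta)$ is the open ball with center $a$ and radius $\delta$; ${\rm bd}$, ${\rm int}$ denote boundary and interior; ${\rm dom} f=\{y:f(y)<+\infty\}$; $\mathbf{d}(x,D):=\inf\{\|x-y\|:y\in D\}$. Excess: $\mathbf{e}(C,D):=\sup_{x\in C}\mathbf{d}(x,D)$, with $\mathbf{e}(\emptyset,D)=0$ if $D\ne\emptyset$ and $=\infty$ otherwise. For convex $f$, $\mathbf{d}^+f(y,v):=\lim_{t\to0^+}\frac{f(y+tv)-f(y)}{t}$. Bouligand tangent cone $\mathbf{T}^{\mathbf B}(C,c)$: all $v$ with $v_n\to v$, $t_n\downarrow0$, $c+t_nv_n\in C$. ''Continuously differentiable'' means Fréchet differentiable with $x\mapsto\nabla g(x)$ continuous in operator norm. $g$ is metrically regular around $\bar x$ if there exist $\kappa>0$ and neighborhoods $U$ of $\bar x$, $V$ of $g(\bar x)$ with $\mathbf{d}(x,g^{-1}(y))\le\kappa\|g(x)-y\|$ for all $(x,y)\in U\times V$. Local error bound at $\bar x$: there exist $\tau,\delta>0$ with $\mathbf{d}(x,\mathcal{S})\le\tau\max\{f(g(x)),0\}$ for all $x\in\mathbf{B}(\bar x,\delta)$; $\tau(\mathcal{S},\bar x)$ is the infimum of all $\tau>0$ for which such a $\delta$ exists (with $\inf\emptyset=+\infty$). $\limsup_{x\xrightarrow{D}\bar x}F(x):=\lim_{\delta\downarrow0}\sup\{F(x):x\in D\cap\mathbf{B}(\bar x,\delta)\}$, with the convention $\sup\emptyset=0$. *)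

(* Defs.v *)
From HB Require Import structures.
From mathcomp Require Import all_boot all_order all_algebra.
From mathcomp Require Import all_classical all_reals all_analysis.
Set Implicit Arguments. Unset Strict Implicit. Unset Printing Implicit Defensive.
Import Order.TTheory GRing.Theory Num.Theory.
Import numFieldNormedType.Exports.
Local Open Scope classical_set_scope.
Local Open Scope ring_scope.

Section Defs.
Context {R : realType}.

Definition bdry {T : topologicalType} (A : set T) : set T :=
  closure A `\` interior A.

Definition edom {Y : Type} (f : Y -> \bar R) : set Y := [set y | (f y < +oo)%E].

Definition proper_fun {Y : Type} (f : Y -> \bar R) : Prop :=
  (exists y, (f y < +oo)%E) /\ (forall y, (-oo < f y)%E).

Definition econvex {Y : normedModType R} (f : Y -> \bar R) : Prop :=
  forall (a b : Y) (t : R), 0 < t < 1 ->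
    (f (t *: a + (1 - t) *: b)%R <= t%:E * f a + (1 - t)%:E * f b)%E.

(* distance to a set: inf over D (inf of empty = +oo) *)
Definition edist {X : normedModType R} (x : X) (D : set X) : \bar R :=
  ereal_inf [set (`|x - y|)%:E | y in D].

Definition excess {X : normedModType R} (C D : set X) : \bar R :=
  if C == set0 then (if D == set0 then +oo%E else 0%E)
  else ereal_sup [set edist x D | x in C].

Definition dplus {Y : normedModType R} (f : Y -> \bar R) (y v : Y) : \bar R :=
  lim ((fun t : R => ((f (y + t *: v)%R - f y) * (t^-1)%:E)%E) @ 0^'+).

Definition bouligand {Y : normedModType R} (C : set Y) (c : Y) : set Y :=
  [set v | exists (vn : Y ^nat) (tn : R ^nat),
      vn @ \oo --> v /\ tn @ \oo --> 0 /\ (forall n, 0 < tn n) /\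
      (forall n, C (c + tn n *: vn n))].

Definition C1 {X Y : normedModType R} (g : X -> Y) : Prop :=
  (forall x, differentiable g x) /\
  (forall x0 (eps : R), 0 < eps -> \forall x \near x0,
      forall h, `|'d g x h - 'd g x0 h| <= eps * `|h|).

Definition metric_regular {X Y : normedModType R} (g : X -> Y) (xbar : X) : Prop :=
  exists kappa : R, 0 < kappa /\ exists U V, nbhs xbar U /\ nbhs (g xbar) V /\
    forall x y, U x -> V y ->
      (edist x (g @^-1` [set y]) <= (kappa * `|g x - y|)%:E)%E.

Definition error_bound_with {X Y : normedModType R} (f : Y -> \bar R) (g : X -> Y)
    (xbar : X) (tau : R) : Prop :=
  exists delta : R, 0 < delta /\ forall x, ball xbar delta x ->
    (edist x [set z | (f (g z) <= 0)%E] <= tau%:E * maxe (f (g x)) 0)%E.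

Definition local_error_bound {X Y : normedModType R} (f : Y -> \bar R) (g : X -> Y)
    (xbar : X) : Prop :=
  exists tau : R, 0 < tau /\ error_bound_with f g xbar tau.

(* tau(S, xbar): infimum of admissible tau (inf of empty = +oo) *)
Definition eb_modulus {X Y : normedModType R} (f : Y -> \bar R) (g : X -> Y)
    (xbar : X) : \bar R :=
  ereal_inf [set tau%:E | tau in [set tau : R | 0 < tau /\ error_bound_with f g xbar tau]].

Definition sup0 (A : set (\bar R)) : \bar R :=
  if A == set0 then 0%E else ereal_sup A.

Definition limsup_in {X : normedModType R} (F : X -> \bar R) (D : set X) (xbar : X)
    : \bar R :=
  lim ((fun delta : R => sup0 [set F x | x in D `&` ball xbar delta]) @ 0^'+).

End Defs.

(* Main.v *)
(** Write [A x] for ['d g x] and [T x] for the tangent cone of [f <= 0] at [g x].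

    Metric regularity, together with completeness of [X] (Graves' iteration),
    makes [A x] open with a constant uniform in [x] near [xbar]. Points and
    directions in [X] can therefore be corrected so that their images in [Y] are
    prescribed exactly, and no continuity of [f] is needed.

    [L <= tau]: if [d+ f (g x) (A x h) <= 1], solve [g q = g x + t A x h] with [q]
    within [o(t)] of [x + t h]. The error bound gives [s] in [S] within
    [tau t + o(t)] of [q]. By convexity [(g s - g x) / t] is tangent, and openness
    of [A x] turns [(s - x) / t] into a vector of [(A x)^-1 (T x)] at distance at
    most [tau + o(1)] of [h].

    [tau <= L]: for [x] outside [S], Ekeland's principle for [`|x - .|] on [S]
    yields [z] in the boundary of [S] such that [x - z] is at distance at least
    [(1 - theta) `|x - z|] of [(A z)^-1 (T z)]. Correct [x - z] to a nearby [h] with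
    [A z h = g x - g z]. Convexity gives [d+ f (g z) (A z h) <= f (g x)], so [h] is
    at distance at most [L f (g x)] of the same cone. *)

Require Import Defs.
From HB Require Import structures.
From mathcomp Require Import all_boot all_order all_algebra.
From mathcomp Require Import all_classical all_reals all_analysis.
From mathcomp Require Import ring lra.
Import Order.TTheory GRing.Theory Num.Theory.
Import numFieldNormedType.Exports.
Local Open Scope classical_set_scope.
Local Open Scope ring_scope.


(* Both names are shadowed by MathComp-Analysis: [edist] is there the distance of
   a pair of points and [sup0] a lemma. *)
Local Notation edist := Defs.edist.
Local Notation sup0 := Defs.sup0.

(** * Completeness: Ekeland's principle and Graves' iteration *)

Section CompleteSpaces.
Context {R : realType}.

Lemma telescoping_norm_le (X : normedModType R) (z : nat -> X) (u : nat -> R) :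
  (forall n, `|z n.+1 - z n| <= u n - u n.+1) ->
  forall n k, `|z (n + k)%N - z n| <= u n - u (n + k)%N.
Proof.
move=> dz n; elim=> [|k IH]; first by rewrite addn0 !subrr normr0.
rewrite addnS; apply: le_trans (ler_distD (z (n + k)%N) _ _) _.
have := dz (n + k)%N; lra.
Qed.

(** [u n] bounds the length of path still to come after [z n]. As [u] decreases to its infimum, the
    tails of [z] shrink. Both iterations below are instances. *)
Lemma telescoping_cvg (X : completeNormedModType R) (z : nat -> X) (u : nat -> R) :
  (forall n, 0 <= u n) ->
  (forall n, `|z n.+1 - z n| <= u n - u n.+1) ->
  exists2 l, z @ \oo --> l & forall n, `|l - z n| <= u n.
Proof.
move=> u0 dz; have dzD := @telescoping_norm_le _ _ _ dz.
have infu : has_inf (range u).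
  by split; [exists (u 0%N), 0%N | exists 0 => _ [n _ <-]].
have /cauchy_cvgP/cvg_ex [l zl] : cauchy (z @ \oo).
  apply: cauchy_exP => e e0.
  have [_ [N _ <-] uN] := inf_adherent e0 infu.
  exists (z N); exists N => // n /= Nn.
  rewrite -ball_normE /= distrC -(subnKC Nn).
  apply: le_lt_trans (dzD _ _) _.
  have : inf (range u) <= u (N + (n - N))%N by apply: ge_inf (infu.2) _ _; exists (N + (n - N))%N.
  lra.
exists l => // n; apply/ler_addgt0Pr => e e0.
have /cvgrPdist_le/(_ _ e0) [N _ zN] := zl.
have := zN (maxn N n) (leq_maxl _ _); rewrite /= => le1.
have := dzD n (maxn N n - n)%N; rewrite subnKC ?leq_maxr // => le2.
apply: le_trans (ler_distD (z (maxn N n)) _ _) _.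
have := u0 (maxn N n); lra.
Qed.

(** [D p] is the part of [S] below [p] in Ekeland's order. Each [z n.+1] minimises [phi] over
    [D (z n)] up to [n.+1%:R^-1]. The limit lies in every [D (z n)]; a point violating the last
    clause would too, so [phi] could not be smaller there than at the limit. *)
Lemma ekeland_variational_principle (X : completeNormedModType R) (S : set X)
    (phi : X -> R) (eps : R) (z0 : X) :
  closed S -> continuous phi -> (forall x, 0 <= phi x) -> 0 < eps -> S z0 ->
  exists z, [/\ S z, phi z + eps * `|z - z0| <= phi z0 &
    forall z', S z' -> phi z <= phi z' + eps * `|z' - z|].
Proof.
move=> clS phic phi0 e0 Sz0.
pose D p := [set q | S q /\ phi q + eps * `|q - p| <= phi p].
have step (p : X * nat) : exists q, S p.1 -> D p.1 q /\
    forall w, D p.1 w -> phi q <= phi w + p.2.+1%:R^-1.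
  have [Sp|] := pselect (S p.1); last by exists z0.
  have hi : has_inf (phi @` D p.1).
    split; last by exists 0 => _ [w _ <-].
    by exists (phi p.1), p.1; rewrite //= /D /= subrr normr0 mulr0 addr0.
  have n0 : 0 < p.2.+1%:R^-1 :> R by rewrite invr_gt0 ltr0n.
  have [_ [q Dq <-] qlt] := inf_adherent n0 hi.
  exists q => _; split=> // w Dw.
  have : inf (phi @` D p.1) <= phi w by apply: ge_inf hi.2 _ _; exists w.
  by move=> h; apply: ltW (lt_le_trans qlt _); rewrite lerD2r.
have [F HF] := choice step.
pose z := fix z n := if n is m.+1 then F (z m, m) else z0.
have Sz n : S (z n) by elim: n => //= n IH; have [[]] := HF (z n, n) IH.
have zS n : D (z n) (z n.+1) by have [] := HF (z n, n) (Sz n).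
have dz n : `|z n.+1 - z n| <= phi (z n) / eps - phi (z n.+1) / eps.
  rewrite -mulrBl ler_pdivlMr // mulrC.
  have [_] := zS n; lra.
have [l zl _] := @telescoping_cvg _ z (fun n => phi (z n) / eps)
   (fun n => divr_ge0 (phi0 _) (ltW e0)) dz.
have dzD := @telescoping_norm_le _ z (fun n => phi (z n) / eps) dz.
have phil : phi (z n) @[n --> \oo] --> phi l.
  by apply: continuous_cvg => //; exact: phic.
have lD n : phi l + eps * `|l - z n| <= phi (z n).
  apply/ler_addgt0Pr => e e1.
  have he : 0 < e / 2 by lra.
  have he' : 0 < e / 2 / eps by rewrite divr_gt0.
  have /cvgrPdist_le/(_ _ he) [N1 _ H1] := phil.
  have /cvgrPdist_le/(_ _ he') [N2 _ H2] := zl.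
  pose m := maxn n (maxn N1 N2).
  have := H1 m; rewrite /m /= !leq_max leqnn orbT => /(_ isT); rewrite ler_norml => /andP[_ h1].
  have := H2 m; rewrite /m /= !leq_max leqnn !orbT => /(_ isT).
  rewrite ler_pdivlMr // => h2.
  have := dzD n (m - n)%N; rewrite subnKC ?leq_maxl // -mulrBl ler_pdivlMr // => h3.
  have h4 := ler_distD (z m) l (z n).
  have h5 : eps * `|l - z n| <= eps * (`|l - z m| + `|z m - z n|) by rewrite ler_wpM2l // ltW.
  rewrite -/m in h1 h2; lra.
exists l; split.
- by apply: (closed_cvg S clS _ _ zl); exists 0%N.
- exact: (lD 0%N).
- move=> w Sw; rewrite leNgt; apply/negP => lw.
  have wD n : D (z n) w.
    split=> //; have := lD n; have := ler_distD l w (z n) => h1 h2.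
    have h5 : eps * `|w - z n| <= eps * (`|w - l| + `|l - z n|) by rewrite ler_wpM2l // ltW.
    lra.
  have lew : phi l <= phi w.
    apply/ler_addgt0Pr => e e1.
    have [n ne] : exists n, n.+1%:R^-1 <= e.
      exists (Num.truncn e^-1); rewrite -[leRHS]invrK lef_pV2 ?posrE ?ltr0n ?invr_gt0 //.
      by rewrite ltW // truncnS_gt.
    have := lD n.+1; have [_ /(_ _ (wD n))] := HF (z n, n) (Sz n).
    move=> h1 h2; have : 0 <= eps * `|l - z n.+1| by rewrite mulr_ge0 // ltW.
    move: ne h1 h2; rewrite -/(z n.+1) /=; move: (_^-1) => c; lra.
  have : 0 <= eps * `|w - l| by rewrite mulr_ge0 // ltW.
  lra.
Qed.

(** Graves' iteration: each step solves approximately for the residual [r n], which is at least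
    halved. The steps are then summable with potential [K * 2 * |r n|]. *)
Lemma almost_open_linear_open (X : completeNormedModType R) (Y : normedModType R)
    (A : {linear X -> Y}) (K : R) :
  continuous A -> 0 <= K ->
  (forall v, exists2 w, `|w| <= K * `|v| & `|A w - v| <= `|v| / 2) ->
  forall v, exists2 w, A w = v & `|w| <= K * 2 * `|v|.
Proof.
move=> Ac K0 aopen v.
have /choice [F HF] : forall v, exists w, `|w| <= K * `|v| /\ `|A w - v| <= `|v| / 2.
  by move=> u; have [w] := aopen u; exists w.
pose z := fix z n := if n is m.+1 then z m + F (v - A (z m)) else 0.
pose r n := v - A (z n).
have rS n : `|r n.+1| <= `|r n| / 2.
  rewrite /r /= linearD opprD addrA distrC; exact: (HF _).2.
have dz n : `|z n.+1 - z n| <= K * 2 * `|r n| - K * 2 * `|r n.+1|.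
  rewrite /= [z n + _]addrC addrK.
  have h : K * 2 * `|r n.+1| <= K * 2 * (`|r n| / 2) by rewrite ler_wpM2l ?rS //; lra.
  have := (HF (r n)).1; rewrite -/(r n); lra.
have [w zw wz] := @telescoping_cvg _ z (fun n => K * 2 * `|r n|)
  (fun n => mulr_ge0 (mulr_ge0 K0 (ler0n _ 2)) (normr_ge0 _)) dz.
exists w; last by have := wz 0%N; rewrite /= subr0 /r /= linear0 subr0.
have rn n : `|r n| <= `|v| * 2^-1 ^+ n.
  elim: n => [|n IH]; first by rewrite /r /= linear0 subr0 expr0 mulr1.
  by rewrite exprSr mulrA; apply: le_trans (rS n) _; rewrite ler_wpM2r.
have Azv : A (z n) @[n --> \oo] --> v.
  apply/cvgrPdist_le => e e0.
  have : `|v| * 2^-1 ^+ n @[n --> \oo] --> (0 : R).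
    by apply: cvg_geometric; rewrite ger0_norm ?invr_ge0 // invf_lt1 // ltr1n.
  move=> /cvgrPdist_le/(_ _ e0); apply: filterS => n; rewrite sub0r normrN.
  move=> h; apply: le_trans (rn n) (le_trans (ler_norm _) h).
have AzAw : A (z n) @[n --> \oo] --> A w by apply: continuous_cvg => //; exact: Ac.
exact: cvg_unique AzAw Azv.
Qed.

End CompleteSpaces.

(** * Strict differentiability of continuously differentiable maps *)

Section Differentiation.
Context {R : realType}.

Lemma nbhs_norm_lt (X : normedModType R) (x : X) (P : set X) :
  nbhs x P -> exists2 r : R, 0 < r & forall x', `|x' - x| < r -> P x'.
Proof.
move=> /nbhs_normP [r r0 H]; exists r => // x' x'r; apply: H.
by rewrite /ball_ /= distrC.
Qed.


Lemma diff_approx (X Y : normedModType R) (g : X -> Y) (x : X) (eps : R) :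
  differentiable g x -> 0 < eps ->
  exists2 r : R, 0 < r & forall x', `|x' - x| < r ->
    `|g x' - g x - 'd g x (x' - x)| <= eps * `|x' - x|.
Proof.
move=> dg e0; have := diff_locally dg; set o := 'o _ => E.
have : \forall h \near (0 : X), `|o h| <= eps * `|h| by exact: littleoP.
move=> /nbhs_normP [r r0 H]; exists r => // x' x'r.
have := H (x' - x); rewrite /ball_ /= sub0r normrN => /(_ x'r) oh.
move: (congr1 (fun k => k (x' - x)) E); rewrite /= subrK => ->.
by rewrite !fctE /= -[X in `|X|]addrA -opprD [X in `|X|]addrC addKr.
Qed.

(* The set of [s] with [`|phi s - phi 0| <= c * s] contains its supremum, and
   the local bound there lets one go beyond it unless it is [1]. *)
Lemma local_lipschitz_segment (Y : normedModType R) (phi : R -> Y) (c : R) :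
  (forall s, 0 <= s <= 1 -> exists2 r : R, 0 < r &
    forall s', `|s' - s| < r -> `|phi s' - phi s| <= c * `|s' - s|) ->
  `|phi 1 - phi 0| <= c.
Proof.
move=> loc; pose E := [set s : R | 0 <= s <= 1 /\ `|phi s - phi 0| <= c * s].
have E0 : E 0 by split; rewrite ?lexx ?ler01 // subrr normr0 mulr0.
have hE : has_sup E by split; [exists 0 | exists 1 => s [/andP[]]].
have s0 : 0 <= sup E by apply: ub_le_sup hE.2 _ _.
have s1 : sup E <= 1 by apply: ge_sup; [exists 0 | move=> s [/andP[]]].
have [r r0 Hr] : exists2 r : R, 0 < r & forall s', `|s' - sup E| < r ->
    `|phi s' - phi (sup E)| <= c * `|s' - sup E| by apply: loc; rewrite s0.
have Es : `|phi (sup E) - phi 0| <= c * sup E.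
  have [s [s01 Hs] ss] := sup_adherent r0 hE.
  have ls : s <= sup E by apply: ub_le_sup hE.2 _ _.
  have := Hr s; rewrite (distrC s) ger0_norm ?subr_ge0 // => /(_ _) h.
  apply: le_trans (ler_distD (phi s) _ _) _; rewrite distrC.
  have := h; rewrite ltrBlDr -ltrBlDl => /(_ _); lra.
have [se|sn1] := eqVneq (sup E) 1; first by move: Es; rewrite se mulr1.
have lt1 : sup E < 1 by rewrite lt_neqAle sn1.
pose d := Num.min (r / 2) (1 - sup E).
have d0 : 0 < d by rewrite lt_min; apply/andP; split; lra.
have dr : d <= r / 2 by rewrite ge_min lexx.
have d1 : d <= 1 - sup E by rewrite ge_min lexx orbT.
have : E (sup E + d).
  split; first by apply/andP; split; lra.
  have := Hr (sup E + d); rewrite addrAC subrr add0r gtr0_norm // => /(_ _) h.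
  apply: le_trans (ler_distD (phi (sup E)) _ _) _.
  have : d < r by lra.
  move=> /h; lra.
by move=> /(ub_le_sup hE.2); rewrite gerDl leNgt d0.
Qed.

(** The mean value inequality on the segment from [z] to [x], for [g] minus its derivative at
    [xbar]. One quarter of [eps] pays for differentiability at a point of the segment, one for
    moving the derivative from there to [xbar], one for moving it from [xbar] to [z]. *)
Lemma C1_strictly_differentiable (X Y : normedModType R) (g : X -> Y) (xbar : X)
    (eps : R) : C1 g -> 0 < eps ->
  exists2 r : R, 0 < r & forall x z, `|x - xbar| < r -> `|z - xbar| < r ->
    `|g x - g z - 'd g z (x - z)| <= eps * `|x - z|.
Proof.
move=> [dg dgc] e0; have e4 : 0 < eps / 4 by lra.
have [r r0 Hr] := nbhs_norm_lt _ _ _ (dgc xbar _ e4).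
exists r => // x z xr zr; pose n := `|x - z|.
pose seg s := z + s *: (x - z).
pose phi s := g (seg s) - 'd g xbar (seg s).
have segB s c : seg s - seg c = (s - c) *: (x - z).
  by rewrite /seg opprD addrACA subrr add0r scalerBl.
have phiB s c : phi s - phi c = g (seg s) - g (seg c) - 'd g xbar (seg s - seg c).
  rewrite /phi ['d g xbar (_ - _)]linearB !opprB -!addrA; congr (_ + _); by rewrite addrC -addrA addrCA.
have : `|phi 1 - phi 0| <= eps / 2 * n.
  apply: local_lipschitz_segment => c /andP[c0 c1].
  have ur : `|seg c - xbar| < r.
    have -> : seg c - xbar = c *: (x - xbar) + (1 - c) *: (z - xbar).
      by rewrite scalerBl scale1r addrCA -scalerBr opprB [x - _ + _]addrA subrK /seg addrAC.
    apply: le_lt_trans (ler_normD _ _) _; rewrite !normrZ (ger0_norm c0) ger0_norm ?subr_ge0 //.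
    have m1 : `|x - xbar| <= Num.max `|x - xbar| `|z - xbar| by rewrite le_max lexx.
    have m2 : `|z - xbar| <= Num.max `|x - xbar| `|z - xbar| by rewrite le_max lexx orbT.
    have mr : Num.max `|x - xbar| `|z - xbar| < r by rewrite gt_max xr.
    have := ler_wpM2l c0 m1; have := ler_wpM2l (_ : 0 <= 1 - c) m2.
    by rewrite subr_ge0 => /(_ c1); lra.
  have [d d0 Hd] := diff_approx _ _ _ _ _ (dg (seg c)) e4.
  have n0 : 0 < n + 1 by rewrite ltr_wpDl ?normr_ge0.
  (* The [+ 1] covers the case [x = z], where [n] vanishes. *)
  exists (d / (n + 1)); first by rewrite divr_gt0.
  move=> s; rewrite ltr_pdivlMr // => sd.
  have sn : `|seg s - seg c| = `|s - c| * n by rewrite segB normrZ.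
  have /Hd h1 : `|seg s - seg c| < d.
    by rewrite sn; apply: le_lt_trans sd; rewrite ler_wpM2l //; lra.
  have h2 := Hr _ ur (seg s - seg c).
  rewrite phiB mulrAC; apply: le_trans (ler_distD ('d g (seg c) (seg s - seg c)) _ _) _.
  by move: h1 h2; rewrite sn; lra.
have -> : phi 1 - phi 0 = g x - g z - 'd g xbar (x - z).
  have seg1 : seg 1 = x by rewrite /seg scale1r addrC subrK.
  have seg0 : seg 0 = z by rewrite /seg scale0r addr0.
  by rewrite phiB seg1 seg0.
move=> h1; have h2 := Hr _ zr (x - z).
apply: le_trans (ler_distD ('d g xbar (x - z)) _ _) _.
have := mulr_ge0 (ltW e0) (normr_ge0 (x - z)).
move: h1 h2; rewrite (distrC ('d g z _)) /n; lra.
Qed.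

End Differentiation.

(** * Distances, excesses and limits superior *)

Section VariationalNotions.
Context {R : realType}.

Lemma edist_le_norm (X : normedModType R) (x y : X) (D : set X) :
  D y -> (edist x D <= (`|x - y|)%:E)%E.
Proof. by move=> Dy; apply: ereal_inf_lbound; exists y. Qed.

Lemma edist_ltP (X : normedModType R) (x : X) (D : set X) (r : R) :
  (edist x D < r%:E)%E -> exists2 y, D y & `|x - y| < r.
Proof. by move=> /ereal_inf_lt [_ [y Dy <-]]; rewrite lte_fin; exists y. Qed.

Lemma edist_ge0 (X : normedModType R) (x : X) (D : set X) : (0 <= edist x D)%E.
Proof. by apply: le_ereal_inf_tmp => _ [y _ <-]; rewrite lee_fin. Qed.

Lemma excess_ge0 (X : normedModType R) (C D : set X) : (0 <= excess C D)%E.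
Proof.
rewrite /excess; case: ifPn => [_|/set0P[x Cx]]; first by case: ifP.
by apply: le_trans (edist_ge0 _ x D) _; apply: ereal_sup_ubound; exists x.
Qed.

Lemma edist_le_excess (X : normedModType R) (C D : set X) (x : X) :
  C x -> (edist x D <= excess C D)%E.
Proof.
move=> Cx; rewrite /excess; case: ifPn => [/eqP C0|_]; first by rewrite C0 in Cx.
by apply: ereal_sup_ubound; exists x.
Qed.

Lemma excess_le (X : normedModType R) (C D : set X) (c : \bar R) :
  C !=set0 -> (forall x, C x -> (edist x D <= c)%E) -> (excess C D <= c)%E.
Proof.
move=> /set0P /negbTE C0 H; rewrite /excess C0.
by apply: ub_ereal_sup => _ [x Cx <-]; exact: H.
Qed.

(** This turns into infima both [limsup_in] of a nonnegative function and [dplus] of a convex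
    function at one of its zeros. *)
Lemma lim_at_right_inf (F : R -> \bar R) :
  (forall s t, 0 < s -> s <= t -> (F s <= F t)%E) ->
  lim (F @ 0^'+) = ereal_inf [set F t | t in [set t | 0 < t]].
Proof.
move=> Fnd.
have h : (BRight (0 : R) < BInfty _ false)%O by [].
have := @nondecreasing_at_right_cvge R F 0 (BInfty _ false) h.
have -> : [set` Interval (BRight (0 : R)) (BInfty _ false)] = [set t | 0 < t].
  by apply/seteqP; split => t /=; rewrite in_itv /= andbT.
move=> cF; apply: (cvg_lim (@ereal_hausdorff R)); apply: cF => s t.
by rewrite !in_itv /= !andbT => s0 _; exact: Fnd.
Qed.

(** Since [F] is nonnegative, the value 0 that [sup0] gives to the empty set lies below every other
    value, so monotonicity in the radius survives the convention. *)
Lemma limsup_in_inf (X : normedModType R) (F : X -> \bar R) (D : set X) (xbar : X) :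
  (forall x, (0 <= F x)%E) ->
  limsup_in F D xbar = ereal_inf
    [set sup0 [set F x | x in D `&` ball xbar d] | d in [set d | 0 < d]].
Proof.
move=> F0; apply: lim_at_right_inf => s t s0 st; rewrite /sup0.
case: ifPn => [_|/set0P[_ [x [Dx xs] _]]].
  case: ifPn => // /set0P[_ [x Dx _]].
  by apply: le_trans (F0 x) _; apply: ereal_sup_ubound; exists x.
have sub : D `&` ball xbar s `<=` D `&` ball xbar t.
  by move=> y [Dy ys]; split=> //; exact: le_ball st _ ys.
case: ifPn => [/eqP E|_].
  have : [set F x | x in D `&` ball xbar t] (F x) by exists x => //; apply: sub.
  by rewrite E.
by apply: le_ereal_sup => _ [y Dy <-]; exists y => //; exact: sub.
Qed.

Lemma limsup_in_ge0 (X : normedModType R) (F : X -> \bar R) (D : set X) (xbar : X) :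
  (forall x, (0 <= F x)%E) -> (0 <= limsup_in F D xbar)%E.
Proof.
move=> F0; rewrite limsup_in_inf //; apply: le_ereal_inf_tmp => _ [d _ <-].
rewrite /sup0; case: ifPn => // /set0P[_ [x Dx _]].
by apply: le_trans (F0 x) _; apply: ereal_sup_ubound; exists x.
Qed.

Lemma limsup_in_le (X : normedModType R) (F : X -> \bar R) (D : set X) (xbar : X)
    (c : \bar R) (d : R) :
  (forall x, (0 <= F x)%E) -> 0 < d -> (0 <= c)%E ->
  (forall x, D x -> ball xbar d x -> (F x <= c)%E) -> (limsup_in F D xbar <= c)%E.
Proof.
move=> F0 d0 c0 H; rewrite limsup_in_inf //; apply: ge_ereal_inf.
exists (sup0 [set F x | x in D `&` ball xbar d]); first by exists d.
rewrite /sup0; case: ifPn => // _.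
by apply: ub_ereal_sup => _ [y [Dy yd] <-]; exact: H.
Qed.

Lemma limsup_in_lt (X : normedModType R) (F : X -> \bar R) (D : set X) (xbar : X)
    (c : \bar R) :
  (forall x, (0 <= F x)%E) -> (limsup_in F D xbar < c)%E ->
  exists2 d : R, 0 < d & forall x, D x -> `|x - xbar| < d -> (F x < c)%E.
Proof.
move=> F0; rewrite limsup_in_inf // => /ereal_inf_lt [_ [d d0 <-]] lt.
exists d => // x Dx xd; apply: le_lt_trans lt.
have Dxd : (D `&` ball xbar d) x by split=> //; rewrite -ball_normE /= distrC.
rewrite /sup0; case: ifPn => [/eqP E|_]; last by apply: ereal_sup_ubound; exists x.
have : [set F x | x in D `&` ball xbar d] (F x) by exists x.
by rewrite E.
Qed.

(** * Convex functions along rays and tangent directions *)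

Lemma econvex_ray (Y : normedModType R) (f : Y -> \bar R) (y v : Y) (s t : R) :
  econvex f -> f y = 0%E -> 0 < s -> s <= t ->
  (f (y + s *: v)%R <= (s / t)%:E * f (y + t *: v)%R)%E.
Proof.
move=> cf fy s0; rewrite le_eqVlt => /predU1P[<-|st].
  by rewrite divff ?gt_eqF // mul1e.
have t0 : 0 < t by exact: lt_trans st.
have st01 : 0 < s / t < 1 by rewrite divr_gt0 //= ltr_pdivrMr // mul1r.
(* [y + s *: v] is the convex combination of [y + t *: v] and [y] with weight [s / t]. *)
have := cf (y + t *: v) y _ st01; rewrite fy mule0 adde0.
by rewrite scalerDr scalerA divfK ?gt_eqF // addrAC -scalerDl [s / t + _]addrC subrK scale1r.
Qed.

Lemma dplus_inf (Y : normedModType R) (f : Y -> \bar R) (y v : Y) :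
  econvex f -> f y = 0%E ->
  dplus f y v = ereal_inf [set (f (y + t *: v)%R * (t^-1)%:E)%E | t in [set t | 0 < t]].
Proof.
move=> cf fy; rewrite /dplus.
have -> : (fun t => ((f (y + t *: v)%R - f y) * (t^-1)%:E)%E) =
    (fun t => (f (y + t *: v)%R * (t^-1)%:E)%E).
  by apply/funext => t; rewrite fy sube0.
apply: lim_at_right_inf => s t s0 st.
rewrite lee_pdivrMr // -muleA -EFinM muleC [(_^-1 * _)%R]mulrC.
exact: econvex_ray.
Qed.

Lemma dplus_le_quotient (Y : normedModType R) (f : Y -> \bar R) (y v : Y) (t : R) :
  econvex f -> f y = 0%E -> 0 < t ->
  (dplus f y v <= f (y + t *: v)%R * (t^-1)%:E)%E.
Proof.
by move=> cf fy t0; rewrite dplus_inf //; apply: ereal_inf_lbound; exists t.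
Qed.

(** The strict bound provides one step [t0] whose quotient is below [c]; convexity passes it on to
    all shorter steps. *)
Lemma dplus_lt_ray (Y : normedModType R) (f : Y -> \bar R) (y v : Y) (c : R) :
  econvex f -> f y = 0%E -> (dplus f y v < c%:E)%E ->
  exists2 t0 : R, 0 < t0 & forall t, 0 < t -> t <= t0 ->
    (f (y + t *: v)%R <= (c * t)%:E)%E.
Proof.
move=> cf fy; rewrite dplus_inf // => /ereal_inf_lt [_ [t0 t00 <-]] /ltW.
rewrite /= in t00; rewrite lee_pdivrMr // => ft0.
exists t0 => // t tp tt0; apply: le_trans (econvex_ray _ _ _ v _ _ cf fy tp tt0) _.
have tt : (0 <= (t / t0)%:E :> \bar R)%E by rewrite lee_fin divr_ge0 // ltW.
apply: le_trans (lee_wpmul2l tt ft0) _.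
by rewrite -!EFinM mulrCA divfK ?gt_eqF.
Qed.

Lemma bouligand_scale (Y : normedModType R) (C : set Y) (c v : Y) (r : R) :
  0 < r -> bouligand C c v -> bouligand C c (r *: v).
Proof.
move=> r0 [vn [tn [vv [t0 [tp H]]]]].
exists (fun n => r *: vn n), (fun n => tn n / r); split; last split; last split.
- exact: cvgZr.
- by rewrite -(mul0r r^-1); apply: cvgMl.
- by move=> n; rewrite divr_gt0.
- by move=> n; rewrite scalerA divfK ?gt_eqF.
Qed.

Lemma bouligand_of_sublevel (Y : normedModType R) (f : Y -> \bar R) (y v : Y) (t : R) :
  econvex f -> f y = 0%E -> 0 < t -> (f (y + t *: v)%R <= 0)%E ->
  bouligand [set y | (f y <= 0)%E] y v.
Proof.
move=> cf fy t0 ft.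
exists (fun=> v), (fun n => t * n.+1%:R^-1); split; last split; last split.
- exact: cvg_cst.
- by rewrite -(mulr0 t); apply: cvgMr; exact: cvg_harmonic.
- by move=> n; rewrite mulr_gt0 // invr_gt0 ltr0n.
- move=> n /=; have n0 : 0 < n.+1%:R^-1 :> R by rewrite invr_gt0 ltr0n.
  have n1 : t * n.+1%:R^-1 <= t by rewrite ger_pMr // invf_le1 ?ler1n ?ltr0n.
  apply: le_trans (econvex_ray _ _ _ v _ t cf fy (mulr_gt0 t0 n0) n1) _.
  by apply: mule_ge0_le0 => //; rewrite lee_fin divr_ge0 // ltW // mulr_gt0.
Qed.

End VariationalNotions.

(** * Consequences of metric regularity *)

Section RegularMaps.
Context {R : realType} {X Y : completeNormedModType R}.
Implicit Types (f : Y -> \bar R) (g : X -> Y) (x z xbar : X).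

Lemma metric_regular_solve g xbar : metric_regular g xbar ->
  exists K r : R, [/\ 0 < K, 0 < r & forall x y, `|x - xbar| < r ->
    `|y - g xbar| < r -> exists2 x', g x' = y & `|x - x'| <= K * `|g x - y|].
Proof.
move=> [k [k0 [U [V [/nbhs_norm_lt [r1 r10 HU] [/nbhs_norm_lt [r2 r20 HV] H]]]]]].
(* The distance to a fibre need not be attained: with [k + 1] the bound is strict and an actual
   solution exists. If [g x = y] there is no such room, and [x] itself is the solution. *)
exists (k + 1), (Num.min r1 r2); split; [lra| by rewrite lt_min r10 |].
move=> x y; rewrite !lt_min => /andP[/HU Ux _] /andP[_ /HV Vy].
have [<-|gxy] := eqVneq (g x) y; first by exists x; rewrite ?subrr ?normr0 ?mulr0.
have n0 : 0 < `|g x - y| by rewrite normr_gt0 subr_eq0.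
have /edist_ltP [x' gx' xx'] : (edist x (g @^-1` [set y]) < ((k + 1) * `|g x - y|)%:E)%E.
  by apply: le_lt_trans (H _ _ Ux Vy) _; rewrite lte_fin ltr_pM2r //; lra.
by exists x' => //; exact: ltW.
Qed.

(** Solve [g x' = g x + t *: v] by regularity: for small [t], the vector [t^-1 *: (x' - x)] solves
    the linearised equation with relative error 1/2, and Graves' iteration makes the solution
    exact. *)
Lemma metric_regular_diff_open g xbar :
  (forall x, differentiable g x) -> metric_regular g xbar ->
  exists K r : R, [/\ 0 < K, 0 < r & forall x, `|x - xbar| < r ->
    forall v, exists2 w, 'd g x w = v & `|w| <= K * `|v|].
Proof.
move=> dg /metric_regular_solve [K [r0 [K0 r00 solve]]].
have r02 : 0 < r0 / 2 by lra.
have gc : {for xbar, continuous g} by exact: differentiable_continuous.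
have [r1 r10 Hr1] := nbhs_norm_lt _ _ _ ((cvgrPdist_lt _ _).1 gc _ r02).
exists (K * 2), (Num.min r0 r1); split; [lra | by rewrite lt_min r00 |].
move=> x; rewrite lt_min => /andP[xr0 /Hr1 gx].
apply: almost_open_linear_open; [exact: diff_continuous | exact: ltW | move=> v].
have [->|v0] := eqVneq v 0.
  exists 0; first by rewrite !normr0 mulr0.
  by rewrite subr0 ['d g x 0]linear0 normr0 mul0r.
have n0 : 0 < `|v| by rewrite normr_gt0.
have e0 : 0 < (K * 2)^-1 by rewrite invr_gt0; lra.
have [d d0 Hd] := diff_approx _ _ _ _ _ (dg x) e0.
(* The choice [t * |v| = m / 2] keeps the target in the ball where [solve] applies and [x'] within
   [d] of [x]. *)
pose m := Num.min (r0 / 2) (d / K).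
have m0 : 0 < m by rewrite lt_min r02 divr_gt0.
pose t := m / (2 * `|v|).
have t0 : 0 < t by rewrite divr_gt0 // mulr_gt0.
have tv : t * `|v| = m / 2 by rewrite /t; field; rewrite gt_eqF.
have m1 : m <= r0 / 2 by rewrite ge_min lexx.
have m2 : K * m <= d by rewrite mulrC -ler_pdivlMr // ge_min lexx orbT.
have [|x' gx' xx'] := solve x (g x + t *: v) xr0.
  rewrite addrAC; apply: le_lt_trans (ler_normD _ _) _.
  rewrite normrZ gtr0_norm // tv distrC; move: gx; rewrite /=; lra.
move: xx'; rewrite opprD addrA subrr add0r normrN normrZ gtr0_norm // => xx'.
have xd : `|x' - x| < d by rewrite distrC (le_lt_trans xx') // tv; lra.
exists (t^-1 *: (x' - x)).
  by rewrite normrZ gtr0_norm ?invr_gt0 // distrC ler_pdivrMl // mulrCA.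
have -> : 'd g x (t^-1 *: (x' - x)) - v = t^-1 *: ('d g x (x' - x) - t *: v).
  by rewrite linearZ /= scalerBr scalerA mulVf ?gt_eqF // scale1r.
rewrite normrZ gtr0_norm ?invr_gt0 // ler_pdivrMl //.
have := Hd _ xd; rewrite gx' [g x + _]addrC addrK distrC => h; apply: le_trans h _.
rewrite ler_pdivrMl; last lra.
rewrite distrC; apply: le_trans xx' _; lra.
Qed.

Lemma sublevel_closed f g :
  lower_semicontinuous f -> continuous g -> closed [set x | (f (g x) <= 0)%E].
Proof.
move=> /lower_semicontinuousP /(_ 0) of0 gc.
have -> : [set x | (f (g x) <= 0)%E] = g @^-1` (~` [set y | (0 < f y)%E]).
  by apply/seteqP; split=> x /=; rewrite leNgt => /negP.
by apply: (continuous_closedP g).1 => //; exact: open_closedC.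
Qed.

(** If [g x] were interior to the sublevel set of [f], continuity of [g] would make [x] interior to
    its preimage; so [g x] is a boundary point. *)
Lemma bdry_sublevel f g x :
  lower_semicontinuous f -> continuous g ->
  bdry [set y | (f y <= 0)%E] `<=` [set y | f y = 0%E] ->
  bdry [set x | (f (g x) <= 0)%E] x -> f (g x) = 0%E.
Proof.
move=> lf gc bd [xS xI]; apply: bd; split.
  apply: subset_closure; move: xS.
  by rewrite -(closure_id _).1 //; exact: sublevel_closed.
by move=> gxI; apply: xI; exact: (gc x _ gxI).
Qed.

(** Preimages of tangent vectors are tangent to the solution set. From [z + tn n *: w], regularity
    solves [g s = g z + tn n *: vn n] exactly, with a correction that is small compared with
    [tn n]. *)
Lemma bouligand_lift f g xbar : (forall x, differentiable g x) ->
  metric_regular g xbar ->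
  exists2 r : R, 0 < r & forall z w (eta : R), `|z - xbar| < r ->
    bouligand [set y | (f y <= 0)%E] (g z) ('d g z w) -> 0 < eta ->
    exists t s, [/\ 0 < t <= 1, (f (g s) <= 0)%E & `|z + t *: w - s| <= eta * t].
Proof.
move=> dg /metric_regular_solve [K [r0 [K0 r00 solve]]].
have gc : {for xbar, continuous g} by exact: differentiable_continuous.
have [r1 r10 Hr1] := nbhs_norm_lt _ _ _ ((cvgrPdist_lt _ _).1 gc _ r00).
exists (Num.min r0 r1); first by rewrite lt_min r00.
move=> z w eta; rewrite lt_min => /andP[zr0 /Hr1 gz] [vn [tn [vv [t0 [tp H]]]]] eta0.
(* Half of [eta] pays for linearising [g], half for replacing ['d g z w] by [vn n]; the [+ 1] covers
   [w = 0]. *)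
have e0 : 0 < eta / (2 * K * (`|w| + 1)).
  by rewrite divr_gt0 // !mulr_gt0 // ltr_wpDl.
have [d d0 Hd] := diff_approx _ _ _ _ _ (dg z) e0.
have e1 : 0 < eta / (2 * K) by rewrite divr_gt0 // mulr_gt0.
have c1 : z + tn n *: w @[n --> \oo] --> z.
  by rewrite -[X in _ --> X]addr0 -(scale0r w); apply: cvgD; [exact: cvg_cst | exact: cvgZl].
have c2 : g z + tn n *: vn n @[n --> \oo] --> g z.
  rewrite -[X in _ --> X]addr0 -(scale0r ('d g z w)).
  by apply: cvgD; [exact: cvg_cst | exact: cvgZ].
have n1 : \forall n \near \oo, `|z + tn n *: w - xbar| < r0.
  suff: nbhs z [set u | `|u - xbar| < r0] by move=> /c1.
  apply/nbhs_normP; exists (r0 - `|z - xbar|) => /=; first by rewrite subr_gt0.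
  move=> u; rewrite /ball_ /= => zu; have := ler_distD z u xbar; rewrite (distrC u z); lra.
have n2 : \forall n \near \oo, `|g z + tn n *: vn n - g xbar| < r0.
  suff: nbhs (g z) [set u | `|u - g xbar| < r0] by move=> /c2.
  apply/nbhs_normP; exists (r0 - `|g xbar - g z|) => /=; first by rewrite subr_gt0.
  move=> u; rewrite /ball_ /= => zu; have := ler_distD (g z) u (g xbar).
  rewrite (distrC u (g z)) (distrC (g z) (g xbar)); lra.
have n3 : \forall n \near \oo, `|z - (z + tn n *: w)| < d by exact: (cvgrPdist_lt _ _).1 c1 _ d0.
have n4 : \forall n \near \oo, `|0 - tn n| <= 1 by exact: (cvgrPdist_le _ _).1 t0 _ ltr01.
have n5 : \forall n \near \oo, `|'d g z w - vn n| <= eta / (2 * K) by exact: (cvgrPdist_le _ _).1 vv _ e1.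
have [n [N1 N2 N3 N4 N5]] : exists n, [/\ `|z + tn n *: w - xbar| < r0,
    `|g z + tn n *: vn n - g xbar| < r0, `|z - (z + tn n *: w)| < d,
    `|0 - tn n| <= 1 & `|'d g z w - vn n| <= eta / (2 * K)].
  near \oo => n; exists n; split; by near: n.
have [s gs zs] := solve _ _ N1 N2.
exists (tn n), s; split; first by move: N4; rewrite sub0r normrN gtr0_norm // tp.
  by rewrite gs; exact: H.
move: N3; rewrite distrC => /Hd.
rewrite [z + _ - z]addrAC subrr add0r ['d g z (_ *: _)]linearZ /= normrZ gtr0_norm // => h1.
apply: le_trans zs _.
have h2 : `|tn n *: 'd g z w - tn n *: vn n| <= tn n * (eta / (2 * K)).
  by rewrite -scalerBr normrZ gtr0_norm // ler_wpM2l // ltW.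
have h3 : `|g (z + tn n *: w) - (g z + tn n *: vn n)| <= tn n * (eta / K).
  rewrite opprD addrA; apply: le_trans (ler_distD (tn n *: 'd g z w) _ _) _.
  have h4 : eta / (2 * K * (`|w| + 1)) * (tn n * `|w|) <= tn n * (eta / (2 * K)).
    rewrite [leLHS]mulrCA ler_wpM2l ?(ltW (tp n)) //.
    have -> : eta / (2 * K * (`|w| + 1)) * `|w| = eta / (2 * K) * (`|w| / (`|w| + 1)).
      by field; rewrite !gt_eqF // ltr_wpDl.
    by rewrite ger_pMr // ler_pdivrMr ?ltr_wpDl // mul1r lerDl.
  have -> : eta / K = eta / (2 * K) + eta / (2 * K) by field; rewrite gt_eqF.
  by rewrite mulrDr; apply: lerD h2; exact: le_trans h1 h4.
apply: le_trans (ler_wpM2l (ltW K0) h3) _.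
by rewrite mulrCA [K * _]mulrC divfK ?gt_eqF // mulrC.
Unshelve. all: by end_near.
Qed.

End RegularMaps.

(** * Error bound constants against excesses at boundary points *)

Section ErrorBounds.
Context {R : realType} {X Y : completeNormedModType R}.
Context (g : X -> Y) (f : Y -> \bar R) (xbar : X).
Context (g1 : C1 g) (lf : lower_semicontinuous f) (cf : econvex f).
Context (bdf : bdry [set y | (f y <= 0)%E] `<=` [set y | f y = 0%E]).
Context (mrg : metric_regular g xbar).

Let Sfg := [set x | (f (g x) <= 0)%E].
Let tangents x := 'd g x @^-1` bouligand [set y | (f y <= 0)%E] (g x).
Let slopes x := [set h | (dplus f (g x) ('d g x h) <= 1)%E].

Let gc : continuous g.
Proof. by move=> x; apply: differentiable_continuous; exact: g1.1. Qed.

Lemma excess_le_error_bound (tau : R) : 0 < tau -> error_bound_with f g xbar tau ->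
  exists2 d : R, 0 < d & forall x, bdry Sfg x -> ball xbar d x ->
    (excess (slopes x) (tangents x) <= tau%:E)%E.
Proof.
move=> tau0 [delta [delta0 eb]].
have [K [r [K0 r0 solve]]] := metric_regular_solve _ _ mrg.
have [K' [r' [K'0 r'0 dopen]]] := metric_regular_diff_open _ _ g1.1 mrg.
have r2 : 0 < r / 2 by lra.
have [r1 r10 Hr1] := nbhs_norm_lt _ _ _ ((cvgrPdist_lt _ _).1 (gc xbar) _ r2).
exists (Num.min (Num.min (r / 2) (delta / 2)) (Num.min r' r1)).
  by rewrite !lt_min r2 r'0 r10 divr_gt0.
move=> x bx; rewrite -ball_normE /= distrC !lt_min.
move=> /andP[/andP[xr xdelta] /andP[xr' /Hr1 /= gxr]].
have fy : f (g x) = 0%E by exact: bdry_sublevel bx.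
apply: excess_le.
  (* The zero direction has slope at most 0, so [slopes x] is nonempty and its excess is a
     supremum. *)
  exists 0; rewrite /slopes /= ['d g x 0]linear0.
  apply: le_trans (dplus_le_quotient _ _ _ _ _ cf fy ltr01) _.
  by rewrite scaler0 addr0 fy mul0e lee01.
move=> h hC; apply/lee_addgt0Pr => eta eta0.
(* [t * N] will bound [|s - x|], and [Q] collects the coefficients of [e] in the final estimate
   [|h - u| <= tau + e * Q]. *)
pose N := K * `|h| + tau + 1 + tau + `|h|.
have Kh : 0 <= K * `|h| by rewrite mulr_ge0 // ltW.
have N0 : 0 < N by have := normr_ge0 h; rewrite /N; lra.
pose Q := K * `|h| + tau + 1 + K' * N.
have Q0 : 0 < Q by have := mulr_gt0 K'0 N0; rewrite /Q; lra.
pose e := Num.min 1 (eta / Q).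
have e0 : 0 < e by rewrite lt_min ltr01 divr_gt0.
have e1 : e <= 1 by rewrite ge_min lexx.
have eQ : e * Q <= eta by rewrite -ler_pdivlMr // ge_min lexx orbT.
have [d d0 Hd] := diff_approx _ _ _ _ _ (g1.1 x) e0.
have [t0 t00 Ht0] : exists2 t0 : R, 0 < t0 & forall t, 0 < t -> t <= t0 ->
    (f (g x + t *: 'd g x h)%R <= ((1 + e) * t)%:E)%E.
  apply: dplus_lt_ray => //; apply: le_lt_trans hC _; rewrite lte_fin; lra.
pose B := N + `|'d g x h|.
have B0 : 0 < B + 1 by have := normr_ge0 ('d g x h); rewrite /B; lra.
(* [t * B < m] keeps [p], [q] and [s] within the radii of [solve], of the error bound and of the
   linear approximation. *)
pose m := Num.min d (Num.min (r / 2) (delta / 2)).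
have m0 : 0 < m by rewrite !lt_min d0 r2 divr_gt0.
pose t := Num.min t0 (m / (B + 1)).
have tp : 0 < t by rewrite lt_min t00 divr_gt0.
have tt0 : t <= t0 by rewrite ge_min lexx.
have tB : t * B < m.
  have : t * (B + 1) <= m by rewrite -ler_pdivlMr // ge_min lexx orbT.
  lra.
have [md mr mdelta] : [/\ m <= d, m <= r / 2 & m <= delta / 2].
  by split; rewrite !ge_min lexx ?orbT.
have tN : t * N <= t * B by rewrite ler_pM2l // /B lerDl.
have tAh : t * `|'d g x h| <= t * B by rewrite ler_pM2l // /B lerDr ltW.
have th : t * `|h| <= t * N by rewrite ler_pM2l // /N; lra.
pose p := x + t *: h.
have px : p - x = t *: h by rewrite /p addrAC subrr add0r.
have npx : `|p - x| = t * `|h| by rewrite px normrZ gtr0_norm.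
have [||q gq pq] := solve p (g x + t *: 'd g x h).
- apply: le_lt_trans (ler_distD x _ _) _; lra.
- rewrite addrAC; apply: le_lt_trans (ler_normD _ _) _.
  rewrite normrZ gtr0_norm // distrC; lra.
have {}pq : `|p - q| <= e * (t * (K * `|h|)).
  have : `|p - x| < d by lra.
  move=> /Hd; rewrite npx px ['d g x (_ *: _)]linearZ /= => hp.
  apply: le_trans pq _; rewrite opprD addrA.
  by apply: le_trans (ler_wpM2l (ltW K0) hp) _; lra.
have pqK : `|p - q| <= t * (K * `|h|).
  have tK : 0 <= t * (K * `|h|) by rewrite mulr_ge0 // ltW.
  by apply: le_trans pq _; rewrite -[leRHS]mul1r ler_wpM2r.
have qb : ball xbar delta q.
  rewrite -ball_normE /= distrC; apply: le_lt_trans (ler_distD x _ _) _.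
  have := ler_distD p q x; rewrite (distrC q p) npx => hq.
  have : t * (K * `|h|) + t * `|h| <= t * N by rewrite -mulrDr ler_pM2l // /N; lra.
  lra.
(* The extra [e * t] makes the bound strict, so that a point [s] realises it. *)
have /edist_ltP [s fs qs] : (edist q Sfg < ((tau * (1 + e) + e) * t)%:E)%E.
  apply: le_lt_trans (eb _ qb) _.
  have fq : (maxe (f (g q)) 0 <= ((1 + e) * t)%:E)%E.
    have t1e : 0 <= (1 + e) * t by rewrite mulr_ge0 ?ltW //; lra.
    by rewrite ge_max gq Ht0 // lee_fin.
  apply: le_lt_trans (lee_wpmul2l _ fq) _; first by rewrite lee_fin ltW.
  rewrite -EFinM lte_fin; have := mulr_gt0 e0 tp; lra.
have ps : `|p - s| <= t * (tau + e * (K * `|h| + tau + 1)).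
  have := ler_distD q p s; lra.
have sx : `|s - x| <= t * N.
  have := ler_distD p s x; rewrite npx (distrC s p) => h1.
  have : t * (tau + e * (K * `|h| + tau + 1)) <= t * (tau + (K * `|h| + tau + 1)).
    by rewrite ler_pM2l // lerD2l ger_pMl //; lra.
  move=> h2; rewrite /N; lra.
have sd : `|s - x| < d by lra.
(* Openness absorbs the linearisation error into [w]: the image of [s - x + w] is exactly
   [g s - g x], a direction leading into the sublevel set. *)
have [w Aw wn] := dopen _ xr' (g s - g x - 'd g x (s - x)).
have {}wn : `|w| <= t * (e * (K' * N)).
  apply: le_trans wn _.
  have h1 : e * `|s - x| <= e * (t * N) by rewrite ler_pM2l.
  apply: le_trans (ler_wpM2l (ltW K'0) (le_trans (Hd _ sd) h1)) _; lra.
pose u := t^-1 *: (s - x + w).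
have tu : t *: u = s - x + w by rewrite /u scalerA divff ?gt_eqF // scale1r.
have uT : tangents x u.
  apply: (bouligand_of_sublevel _ _ _ _ t) => //.
  have -> : t *: 'd g x u = 'd g x (t *: u) by rewrite -linearZ_LR.
  have -> : 'd g x (t *: u) = g s - g x by rewrite tu linearD Aw addrC subrK.
  by rewrite addrC subrK.
apply: le_trans (edist_le_norm _ _ _ _ uT) _.
rewrite -EFinD lee_fin -(ler_pM2l tp).
have <- : `|t *: (h - u)| = t * `|h - u| by rewrite normrZ gtr0_norm.
rewrite scalerBr tu -px opprD addrA [s - x]addrC opprD opprK addrA subrK.
apply: le_trans (ler_normB _ _) _; rewrite /Q in eQ.
have := ler_wpM2l (ltW tp) eQ; lra.
Qed.

Lemma error_bound_of_excess_lt (lam lam' d : R) :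
  (f (g xbar) <= 0)%E -> 0 < lam -> lam < lam' -> 0 < d ->
  (forall x, bdry Sfg x -> `|x - xbar| < d ->
    (excess (slopes x) (tangents x) < lam%:E)%E) ->
  error_bound_with f g xbar lam'.
Proof.
move=> fxbar lam0 ll' d0 exc; have lam'0 : 0 < lam' by lra.
have [K' [r' [K'0 r'0 dopen]]] := metric_regular_diff_open _ _ g1.1 mrg.
have [r r0 lift] := bouligand_lift f _ _ g1.1 mrg.
(* So [1 - 2 * th = lam / lam']: the estimates [(1 - th) * n <= a] and [a < lam * c + th * n] below
   will combine to [n <= lam' * c]. *)
pose th := (1 - lam / lam') / 2.
have q01 : 0 < lam / lam' < 1 by rewrite divr_gt0 //= ltr_pdivrMr // mul1r.
have [th0 th1] : 0 < th /\ th < 1 / 2 by rewrite /th; split; lra.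
have [r2 r20 sdiff] := C1_strictly_differentiable _ _ _ xbar _ g1 (divr_gt0 th0 K'0).
pose delta := Num.min (Num.min d r') (Num.min r r2) / 2.
have delta0 : 0 < delta by rewrite divr_gt0 // !lt_min d0 r'0 r0.
exists delta; split=> // x; rewrite -ball_normE /= distrC => xdelta.
have [xS|xS] := leP (f (g x)) 0%E.
  apply: le_trans (edist_le_norm _ x x _ xS) _.
  by rewrite subrr normr0 mule_ge0 // lee_fin ltW.
case fgx : (f (g x)) => [c| |]; last by rewrite fgx in xS.
  2: by rewrite gt0_muley ?leey // lte_fin.
have c0 : 0 < c by rewrite fgx lte_fin in xS.
have phic : continuous (fun u : X => `|x - u|).
  move=> u; apply: cvg_norm; apply: cvgB; [exact: cvg_cst | exact: cvg_id].
have th2 : 0 < th / 2 by lra.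
(* Starting from [xbar] gives [|x - z| <= |x - xbar|], hence [z] within [delta * 2] of [xbar]; this
   is why [delta] was halved. *)
have [z [zS zx zmin]] := ekeland_variational_principle _ Sfg (fun u => `|x - u|)
  (th / 2) xbar (sublevel_closed _ _ lf gc) phic (fun=> normr_ge0 _) th2 fxbar.
set n := `|x - z| in zx.
have nx : n < delta.
  have := mulr_ge0 (ltW th2) (normr_ge0 (z - xbar)); lra.
have zdelta : `|z - xbar| < delta * 2.
  by apply: le_lt_trans (ler_distD x _ _) _; rewrite (distrC z x) -/n; lra.
have [zd zr' zr zr2] : [/\ `|z - xbar| < d, `|z - xbar| < r', `|z - xbar| < r &
    `|z - xbar| < r2].
  by move: zdelta; rewrite /delta divfK // !lt_min => /andP[/andP[-> ->] /andP[-> ->]].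
have xr2 : `|x - xbar| < r2.
  have : delta * 2 <= r2 by rewrite /delta divfK // !ge_min lexx !orbT.
  lra.
have n0 : 0 < n.
  rewrite normr_gt0 subr_eq0; apply: contraTneq xS => ->.
  by rewrite -leNgt; exact: zS.
(* From an interior point, a step towards [x] would lower the distance to [x] at rate 1, more than
   the rate [th / 2] allowed by [zmin]. *)
have zb : bdry Sfg z.
  split; first exact: subset_closure.
  move=> /nbhs_norm_lt [rho rho0 Hrho].
  pose t := Num.min 1 (rho / (n * 2)).
  have tp : 0 < t by rewrite lt_min ltr01 divr_gt0 // mulr_gt0.
  have t1 : t <= 1 by rewrite ge_min lexx.
  have tn : `|z + t *: (x - z) - z| = t * n.
    by rewrite addrAC subrr add0r normrZ gtr0_norm.
  have : t * (n * 2) <= rho.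
    by rewrite -ler_pdivlMr ?mulr_gt0 // ge_min lexx orbT.
  have tn0 := mulr_gt0 tp n0; move=> trho.
  have /zmin : Sfg (z + t *: (x - z)) by apply: Hrho; rewrite tn; lra.
  have -> : x - (z + t *: (x - z)) = (1 - t) *: (x - z).
    by rewrite opprD addrA scalerBl scale1r.
  rewrite tn normrZ ger0_norm ?subr_ge0 // -/n.
  have : th / 2 * (t * n) < 1 * (t * n) by rewrite ltr_pM2r //; lra.
  lra.
have fz : f (g z) = 0%E by exact: bdry_sublevel zb.
have [w Aw wn] := dopen _ zr' (g x - g z - 'd g z (x - z)).
have {}wn : `|w| <= th * n.
  apply: le_trans wn _; apply: le_trans (ler_wpM2l (ltW K'0) (sdiff _ _ xr2 zr2)) _.
  by rewrite mulrA [K' * _]mulrC divfK ?gt_eqF.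
pose h := x - z + w.
have Ah : 'd g z h = g x - g z by rewrite /h linearD Aw addrC subrK.
(* The quotient with step [c] is evaluated exactly at [g x], where [f] equals [c]. *)
have hC : slopes z (c^-1 *: h).
  apply: le_trans (dplus_le_quotient _ _ _ _ _ cf fz c0) _.
  rewrite ['d g z (_ *: _)]linearZ /= scalerA divff ?gt_eqF // scale1r Ah addrC subrK.
  by rewrite fgx -EFinM divff ?gt_eqF.
have [k kT hk] : exists2 k, tangents z k & `|c^-1 *: h - k| < lam.
  by apply: edist_ltP; apply: le_lt_trans (exc _ zb zd); exact: edist_le_excess.
have ckT : tangents z (c *: k).
  by rewrite /tangents /= ['d g z (_ *: _)]linearZ /=; exact: bouligand_scale.
set w1 := c *: k in ckT.
have hw1 : `|h - w1| < lam * c.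
  have -> : h - w1 = c *: (c^-1 *: h - k).
    by rewrite scalerBr scalerA divff ?gt_eqF // scale1r.
  by rewrite normrZ gtr0_norm // mulrC ltr_pM2r.
set a := `|x - z - w1|.
have alt : a < lam * c + th * n.
  have -> : a = `|h - w1 - w| by rewrite /h addrAC addrK.
  by apply: le_lt_trans (ler_normB _ _) _; lra.
(* Otherwise lifting [w1] gives [s] in the solution set with [|x - s| <= n - t * th * n] and
   [|s - z| <= t * (2 - th) * n], so [zmin] fails by at least [th * th / 2 * t * n]. *)
have age : (1 - th) * n <= a.
  rewrite leNgt; apply/negP => an.
  have eta0 : 0 < (1 - th) * n - a by lra.
  have [t [s [/andP[tp t1] sS zs]]] := lift z w1 _ zr ckT eta0.
  have h1 : `|x - s| <= t * ((1 - th) * n) + (1 - t) * n.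
    apply: le_trans (ler_distD (z + t *: w1) _ _) _.
    have -> : x - (z + t *: w1) = (1 - t) *: (x - z) + t *: (x - z - w1).
      by rewrite [t *: (_ - w1)]scalerBr [RHS]addrA -scalerDl subrK scale1r opprD addrA.
    have := ler_normD ((1 - t) *: (x - z)) (t *: (x - z - w1)).
    rewrite !normrZ (gtr0_norm tp) ger0_norm ?subr_ge0 // -/n -/a; lra.
  have nw1 : `|w1| <= n + a.
    have := ler_normB (x - z) (x - z - w1).
    by rewrite opprB addrCA subrr addr0.
  have h2 : `|s - z| <= t * ((2 - th) * n).
    apply: le_trans (ler_distD (z + t *: w1) _ _) _.
    rewrite [z + _ - z]addrAC subrr add0r normrZ (gtr0_norm tp) distrC.
    have := ler_wpM2l (ltW tp) nw1; lra.
  have h3 := zmin _ sS; rewrite -/n in h3.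
  have := ler_wpM2l (ltW th2) h2.
  have := mulr_gt0 (mulr_gt0 th0 th0) (mulr_gt0 tp n0).
  lra.
apply: le_trans (edist_le_norm _ x z _ zS) _.
rewrite -EFinM lee_fin -/n.
have : lam / lam' * n <= lam * c by move: (alt) (age); rewrite /th; lra.
by rewrite -mulrA ler_pM2l // ler_pdivrMl.
Qed.

End ErrorBounds.

(** * The modulus as a limit superior *)

Theorem theorem4p4 (R : realType) (X Y : completeNormedModType R)
    (g : X -> Y) (f : Y -> \bar R) (xbar : X) :
  C1 g ->
  proper_fun f -> lower_semicontinuous f -> econvex f ->
  bdry [set y | (f y <= 0)%E] `<=` [set y | f y = 0%E] ->
  (f (g xbar) <= 0)%E ->
  interior (edom f) (g xbar) ->
  metric_regular g xbar ->
  let L := limsup_in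
      (fun x => excess [set h | (dplus f (g x) ('d g x h) <= 1)%E]
                       ('d g x @^-1` bouligand [set y | (f y <= 0)%E] (g x)))
      (bdry [set x | (f (g x) <= 0)%E]) xbar in
  (local_error_bound f g xbar <-> (L < +oo)%E) /\ eb_modulus f g xbar = L.
Proof.
move=> g1 _ lf cf bdf fxbar _ mrg L.
have exc0 x : (0 <= excess [set h | (dplus f (g x) ('d g x h) <= 1)%E]
    ('d g x @^-1` bouligand [set y | (f y <= 0)%E] (g x)))%E by exact: excess_ge0.
have L0 : (0 <= L)%E by exact: limsup_in_ge0.
have modE : eb_modulus f g xbar = L.
  apply/eqP; rewrite eq_le; apply/andP; split; last first.
    apply: le_ereal_inf_tmp => _ [tau [tau0 eb] <-].
    have [d d0 Hd] := excess_le_error_bound _ _ _ g1 lf cf bdf mrg _ tau0 eb.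
    by apply: limsup_in_le d0 _ Hd => //; rewrite lee_fin ltW.
  case EL : L => [l| |]; [|by rewrite leey | by rewrite EL in L0].
  apply/lee_addgt0Pr => e e0; rewrite EL lee_fin in L0.
  (* The constants will be [lam = l + e / 2] and [lam' = l + e], positive even when [l = 0]. *)
  have le : (L < (l + e / 2)%:E)%E by rewrite EL lte_fin; lra.
  have [d d0 Hd] := limsup_in_lt _ _ _ _ _ exc0 le.
  apply: ereal_inf_lbound; exists (l + e) => //; split; first lra.
  apply: (error_bound_of_excess_lt _ _ _ g1 lf cf bdf mrg _ _ _ fxbar _ _ d0 Hd); lra.
(* An infimum of real numbers is below [+oo] exactly when some admissible constant exists. *)
split=> //; rewrite -modE; split.
  move=> [tau [tau0 eb]]; apply: le_lt_trans (ltry tau).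
  by apply: ereal_inf_lbound; exists tau.
by move=> /ereal_inf_lt [_ [tau [tau0 eb] _] _]; exists tau.
Qed.
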